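(* Let $M$ be a smooth manifold, $\{\cdot,\cdot\}$ a generalized Poisson bracket on $M$ with bundle map $J:T^*M\to TM$, $\Delta\subset TM$ a smooth vector subbundle, and $\mathcal D$ the Dirac structure with fibers $\mathcal D(x)=\{(v,v^* )\in T_xM\times T_x^*M \mid v-J(x)v^*\in\Delta(x),\ v^*\in\Delta^\circ(x)\}$. Let $G$ be a Lie group with Lie algebra $\mathfrak g$ acting smoothly on $M$ such that for all $\xi\in\mathfrak g$: $L_{\xi_M}J=0$, and $L_{\xi_M}Z$ is a local section of $\Delta$ whenever $Z$ is. Let $H\in C^\infty(M)$ be $G$-invariant, and let $P:M\to\mathfrak g^*$ be an $Ad^*$-equivariant momentum map, i.e. $(\xi_M,dP_\xi)$ is a section of $\mathcal D$ for all $\xi\in\mathfrak g$. Assume that $V+\Delta$ has constant dimension on $M$, where $V(x)=\mathrm{span}\{\xi_M(x)\mid\xi\in\mathfrak g\}$. Let $M_0=P^{-1}(0)/G$ be the (possibly singular) reduced space with projection $\pi:P^{-1}(0)\to M_0$, let $\mathcal D_0=(\{\cdot,\cdot\}_0,\hat\Delta)$ be the singular reduced Dirac structure on $M_0$, and let $H_0\in C^\infty(M_0)$ be defined by $H_0\circ\pi=H|_{P^{-1}(0)}$. Then for every $G$-projectable solution $x(t)$ of the implicit Hamiltonian system $(M,\mathcal D,H)$ with $x(0)\in P^{-1}(0)$, the curve $\gamma(t)=\pi(x(t))$ is a solution of the singular reduced implicit Hamiltonian system $(M_0,\mathcal D_0,H_0)$.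
   Context: All objects are smooth. A generalized Poisson bracket on $M$ is a skew-symmetric bilinear map $\{\cdot,\cdot\}:C^\infty(M)\times C^\infty(M)\to C^\infty(M)$ satisfying the Leibniz rule (the Jacobi identity and nondegeneracy are not required); $J:T^*M\to TM$ is the skew-symmetric bundle map with $\langle df,J\,dh\rangle=\{f,h\}$. A Dirac structure on $M$ is a vector subbundle $\mathcal D\subset TM\oplus T^*M$ equal to its own orthogonal complement under the pairing $\langle\langle(v,v^* ),(w,w^* )\rangle\rangle=\langle v^*,w\rangle+\langle w^*,v\rangle$. $\Delta^\circ\subset T^*M$ is the annihilator of $\Delta$. $\xi_M$ is the infinitesimal generator of $\xi\in\mathfrak g$, and $P_\xi(x)=\langle P(x),\xi\rangle$. For a vector field $X$ and function $f$, $X[f]=\langle df,X\rangle$. Write $N=P^{-1}(0)$, a $G$-invariant closed subset of $M$. Solutions on $M$: a solution of $(M,\mathcal D,H)$ is a smooth curve $x(t)$ in $M$ with $(\dot x(t),dH(x(t)))\in\mathcal D(x(t))$ for all $t$. Smooth functions on $M_0$: $M_0=N/G$ has the quotient topology. A continuous function $f_0$ on $M_0$ is smooth, $f_0\in C^\infty(M_0)$, if there is $f\in C^\infty(M)^G$ with $f_0\circ\pi=f|_N$. Reduced bracket: $\{f_0,h_0\}_0\circ\pi=\{f,h\}|_N$ for $f_0,h_0\in C^\infty(M_0)$ and any $f,h\in C^\infty(M)^G$ with $f_0\circ\pi=f|_N$, $h_0\circ\pi=h|_N$. Projectability: a (possibly local) vector field $X$ on $M$ projects to $M_0$ if there is a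 derivation $\hat X$ on $C^\infty(M_0)$ such that $X[f](x)=\hat X[f_0](\pi(x))$ for all $x\in N$ (in the domain of $X$) and all $f\in C^\infty(M)^G$, where $f_0\circ\pi=f|_N$. Reduced distribution: $\hat\Delta$ is the vector space of derivations on $C^\infty(M_0)$ locally spanned by $\hat X_1,\dots,\hat X_m$, where $X_1,\dots,X_m$ is a local basis of sections of $\Delta$ consisting of vector fields that project to $M_0$, with projections $\hat X_1,\dots,\hat X_m$ (the construction of $\hat\Delta$ uses the existence of such local bases, under the assumption that $V+\Delta$ has constant dimension). For a derivation $\hat X$ on $C^\infty(M_0)$ and $p\in M_0$, $\hat X(p):C^\infty(M_0)\to\mathbb R$ is $f_0\mapsto\hat X[f_0](p)$, and $\hat\Delta(p)=\{\hat Z(p)\mid\hat Z\in\hat\Delta\}$, i.e. the span of $\hat X_1(p),\dots,\hat X_m(p)$. Singular reduced Dirac structure: the pair $\mathcal D_0=(\{\cdot,\cdot\}_0,\hat\Delta)$. Solutions on $M_0$: a continuous curve $\gamma(t)$ in $M_0$ is smooth if $f_0\circ\gamma$ is smooth for all $f_0\in C^\infty(M_0)$. A smooth curve $\gamma$ is an integral curve of a derivation $\hat X$ on $C^\infty(M_0)$ if $\frac{d}{dt}f_0(\gamma(t))=\hat X[f_0](\gamma(t))$ for all $t$ and all $f_0\in C^\infty(M_0)$. A smooth curve $\gamma$ is a solution of $(M_0,\mathcal D_0,H_0)$ if there is a derivation $\hat X$ on $C^\infty(M_0)$ such that $\gamma$ is an integral curve of $\hat X$ and, for all $t$, $\hat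 X(\gamma(t))-\{\cdot,H_0\}_0(\gamma(t))\in\hat\Delta(\gamma(t))$ and $\hat Z[H_0](\gamma(t))=0$ for all $\hat Z\in\hat\Delta$. $G$-projectable solution: a solution $x(t)$ of $(M,\mathcal D,H)$ for which there is a vector field $X$ on $M$ that projects to a derivation $\hat X$ on $C^\infty(M_0)$ and satisfies $\dot x(t)=X(x(t))$ for all $t$. *)

(* Defs.v *)
From HB Require Import structures.
From mathcomp Require Import all_boot all_order all_algebra.
From mathcomp Require Import all_classical all_reals topology normedtype landau derive.
From mathcomp Require Import ring.
Set Implicit Arguments.
Unset Strict Implicit.
Unset Printing Implicit Defensive.
Import Order.TTheory GRing.Theory Num.Theory numFieldNormedType.Exports.
Local Open Scope classical_set_scope.
Local Open Scope ring_scope.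

Lemma near_eq_differentiable (R : realType) (V W : normedModType R)
    (f g : V -> W) x :
  {near x, f =1 g} -> differentiable f x -> differentiable g x.
Proof.
move=> fg df.
have E : g \o shift x = cst (g x) + 'd f x +o_ 0 id.
  apply/eqaddoP => e e0.
  have /eqaddoP/(_ _ e0) := diff_locally df.
  have : \forall h \near 0, f (h + x) = g (h + x).
    move: fg; rewrite (near_shift 0 x); apply: filterS => h /=.
    by rewrite !subr0.
  by apply: filterS2 => h /= fgh; rewrite !fctE /= -fgh (nbhs_singleton fg).
by apply/diff_locallyP; rewrite (diff_unique (diff_continuous df) E); split=> //;
  exact: diff_continuous.
Qed.

Section smooth.
Context {R : realType}.
Implicit Types V W : normedModType R.

(* f is of class C^k on the open set U: differentiability is total (Frechet)
   differentiability, and the derivative being of class C^(k-1) is tested in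
   every direction v. Meaningful for open U only. *)
Fixpoint Ck_on V W (k : nat) (U : set V) (f : V -> W) : Prop :=
  match k with
  | 0 => forall x, U x -> {for x, continuous f}
  | k.+1 => (forall x, U x -> differentiable f x) /\
            forall v, Ck_on k U (fun x => 'D_v f x)
  end.

Definition smooth_on V W (U : set V) (f : V -> W) := forall k, Ck_on k U f.

Lemma Ck_sub V W k (U U' : set V) (f : V -> W) :
  U' `<=` U -> Ck_on k U f -> Ck_on k U' f.
Proof.
move=> sU; elim: k f => [f Cf x /sU Ux|k IH f /= [df Cf]]; first exact: Cf.
by split=> [x /sU Ux|v]; [exact: df|exact: IH].
Qed.

Lemma Ck_local V W k (U : set V) (f : V -> W) :
  (forall x, U x -> exists2 U', U' x & Ck_on k U' f) -> Ck_on k U f.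
Proof.
elim: k f => [f Cf x Ux|k IH f Cf /=].
  by have [U' U'x Cf'] := Cf x Ux; exact: Cf'.
split=> [x Ux|v]; first by have [U' U'x [df _]] := Cf x Ux; exact: df.
apply: IH => x Ux; have [U' U'x [_ Cf']] := Cf x Ux.
by exists U' => //; exact: Cf'.
Qed.

Lemma Ck_eq V W k (U : set V) (f g : V -> W) : open U ->
  (forall x, U x -> f x = g x) -> Ck_on k U f -> Ck_on k U g.
Proof.
move=> oU.
have nfg (f' g' : V -> W) x : (forall x, U x -> f' x = g' x) -> U x ->
    {near x, f' =1 g'}.
  by move=> fg Ux; near=> y; apply: fg; near: y; exact: open_nbhs_nbhs.
elim: k f g => [f g fg Cf x Ux|k IH f g fg /= [df Cf]].
  move: (Cf x Ux) (nfg _ _ _ fg Ux) => /= fx nx.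
  have fgx : f x = g x by exact: nbhs_singleton nx.
  move: fx; rewrite /prop_for /continuous_at fgx; apply: cvg_trans.
  by move=> A; exact: (near_eq_cvg nx).
split=> [x Ux|v].
  by apply: (near_eq_differentiable (nfg _ _ _ fg Ux)); exact: df.
apply: (IH (fun x => 'D_v f x)) => // x Ux.
by apply: near_eq_derive; exact: nfg.
Unshelve. all: by end_near.
Qed.

Lemma CkW V W k (U : set V) (f : V -> W) : Ck_on k.+1 U f -> Ck_on k U f.
Proof.
elim: k f => [f [df _] x Ux|k IH f /= [df Cf]].
  by apply: differentiable_continuous; exact: df.
by split=> // v; apply: IH; exact: Cf.
Qed.

Lemma Ck_cst V W k (U : set V) (c : W) : Ck_on k U (cst c).
Proof.
elim: k c => [|k IH] c /=; first by move=> x _; exact: cst_continuous.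
split=> [x _|v]; first exact: differentiable_cst.
rewrite (_ : (fun x => _) = cst 0) //; apply/funext => x.
exact: derive_cst.
Qed.

Lemma Ck_add V W k (U : set V) (f g : V -> W) : open U ->
  Ck_on k U f -> Ck_on k U g -> Ck_on k U (f + g).
Proof.
move=> oU; elim: k f g => [f g Cf Cg x Ux|k IH f g /= [df Cf] [dg Cg]].
  by apply: continuousD; [exact: Cf|exact: Cg].
split=> [x Ux|v]; first by apply: differentiableD; [exact: df|exact: dg].
apply: (@Ck_eq _ _ _ _ ('D_v f + 'D_v g)) => //; last exact: IH.
by move=> x Ux; rewrite deriveD //; apply: diff_derivable; [exact: df|exact: dg].
Qed.

Lemma Ck_sum V W k (U : set V) n (f : 'I_n -> V -> W) : open U ->
  (forall i, Ck_on k U (f i)) -> Ck_on k U (\sum_i f i).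
Proof.
move=> oU Cf; elim/big_ind: _ => //; first exact: Ck_cst.
by move=> g h; exact: Ck_add.
Qed.

Lemma Ck_mul V k (U : set V) (f g : V -> R) : open U ->
  Ck_on k U f -> Ck_on k U g -> Ck_on k U (f * g).
Proof.
move=> oU; elim: k f g => [f g Cf Cg x Ux|k IH f g Cf' Cg' /=].
  by apply: continuousM; [exact: Cf|exact: Cg].
have [df Cf] := Cf'; have [dg Cg] := Cg'.
split=> [x Ux|v]; first by apply: differentiableM; [exact: df|exact: dg].
apply: (@Ck_eq _ _ _ _ (f * 'D_v g + g * 'D_v f)) => //.
  move=> x Ux; rewrite deriveM //; apply: diff_derivable; [exact: df|exact: dg].
by apply: Ck_add => //; apply: IH; [exact: CkW|exact: Cg|exact: CkW|exact: Cf].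
Qed.

Lemma Ck_lin V W W' k (U : set V) (L : {linear W -> W'}) (f : V -> W) :
  continuous L -> open U -> Ck_on k U f -> Ck_on k U (L \o f).
Proof.
move=> cL oU; elim: k f => [f Cf x Ux|k IH f /= [df Cf]].
  by apply: continuous_comp; [exact: Cf|exact: cL].
have dL y : differentiable L y by exact: linear_differentiable.
have dLf x : U x -> differentiable (L \o f) x.
  by move=> Ux; apply: differentiable_comp; [exact: df|exact: dL].
split=> // v.
apply: (@Ck_eq _ _ _ _ (L \o (fun x => 'D_v f x))) => //; last exact: IH.
move=> x Ux; rewrite (deriveE _ (dLf x Ux)) /= (deriveE _ (df x Ux)).
rewrite (diff_comp (df x Ux) (dL _)) /=.
by rewrite (diff_lin _ cL).
Qed.

Lemma Ck_comp V n k (U : set V) (U' : set 'rV[R]_n) (f : V -> 'rV[R]_n)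
    (g : 'rV[R]_n -> R) : open U -> (forall x, U x -> U' (f x)) ->
  Ck_on k U f -> Ck_on k U' g -> Ck_on k U (g \o f).
Proof.
move=> oU fU; elim: k g => [g Cf Cg x Ux|k IH g Cf' Cg' /=].
  by apply: continuous_comp; [exact: Cf|exact/Cg/fU].
have [df Cf] := Cf'; have [dg Cg] := Cg'.
split=> [x Ux|v].
  by apply: differentiable_comp; [exact: df|exact/dg/fU].
pose e (i : 'I_n) : 'rV[R]_n := delta_mx 0 i.
pose h i : V -> R := (fun x => ('D_v f x) 0 i) * ('D_(e i) g \o f).
apply: (@Ck_eq _ _ _ _ (\sum_i h i)) => //.
  move=> x Ux; rewrite fct_sumE.
  have dfx := df _ Ux; have dgx := dg _ (fU _ Ux).
  have dgf : differentiable (g \o f) x by exact: differentiable_comp.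
  rewrite [RHS](deriveE _ dgf) diff_comp //=.
  rewrite [in RHS](row_sum_delta ('d f x v)) linear_sum.
  by apply: eq_bigr => i _; rewrite linearZ /= -(deriveE _ dfx) -(deriveE _ dgx).
apply: Ck_sum => // i; apply: Ck_mul => //.
  pose L : 'rV[R]_n -> R := fun M => M 0 i.
  have Ll : linear (L : _ -> R^o) by move=> a u w; rewrite /L !mxE.
  pose L' : {linear 'rV[R]_n -> R^o} := HB.pack (L : _ -> R^o)
    (GRing.isLinear.Build _ _ _ _ (L : _ -> R^o) Ll).
  have : Ck_on k U (L' \o (fun x => 'D_v f x)).
    by apply: Ck_lin; [exact: coord_continuous|by []|exact: Cf].
  by [].
by apply: (IH (fun y => 'D_(e i) g y)); [exact: CkW|exact: Cg].
Qed.

Lemma Ck_affine V V' W k (U : set V) (U' : set V') (L : {linear V -> V'}) (c : V')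
    (g : V' -> W) : continuous L -> open U -> (forall x, U x -> U' (L x + c)) ->
  Ck_on k U' g -> Ck_on k U (fun x => g (L x + c)).
Proof.
move=> cL oU LU.
have dL x : is_diff x (fun x => L x + c) L.
  have dLx : is_diff x L L.
    by apply: DiffDef; [exact: linear_differentiable|exact: diff_lin].
  have := is_diffD dLx (is_diff_cst c x).
  by rewrite addr0.
have cA : continuous (fun x => L x + c).
  by move=> x; apply: differentiable_continuous; case: (dL x).
elim: k g => [g Cg x Ux|k IH g /= [dg Cg]].
  apply: (@continuous_comp _ _ _ (fun x => L x + c) g); first exact: cA.
  exact/Cg/LU.
have dgA x : U x -> differentiable (g \o (fun x => L x + c)) x.
  by move=> Ux; apply: differentiable_comp; [case: (dL x)|exact/dg/LU].
split=> // v.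
apply: (@Ck_eq _ _ _ _ (fun x => 'D_(L v) g (L x + c))) => //; last first.
  exact: (IH (fun y => 'D_(L v) g y)).
move=> x Ux; rewrite [RHS](deriveE _ (dgA _ Ux)) diff_comp /=; last first.
    exact/dg/LU.
  by case: (dL x).
have [_ ->] := dL x; by rewrite deriveE //; exact/dg/LU.
Qed.

Lemma Ck_pairl V V' W k (U : set V) (U' : set (V * V')) (g : V * V' -> W) c :
  open U -> (forall x, U x -> U' (x, c)) -> Ck_on k U' g ->
  Ck_on k U (g \o (fun x => (x, c))).
Proof.
move=> oU UU' Cg; pose L (x : V) : V * V' := (x, 0).
have Ll : linear L.
  by move=> a u v; congr pair; rewrite /= scaler0 addr0.
pose L' : {linear V -> (V * V')%type} :=
  HB.pack L (GRing.isLinear.Build _ _ _ _ L Ll).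
have E x : L' x + (0, c) = (x, c) by congr pair; rewrite /= ?addr0 ?add0r.
have -> : g \o (fun x => (x, c)) = fun x => g (L' x + (0, c)).
  by apply/funext => x /=; rewrite E.
apply: (@Ck_affine _ _ _ _ _ U') => //; last by move=> x Ux; rewrite E; exact: UU'.
by move=> x; apply: cvg_pair; [exact: cvg_id|exact: cvg_cst].
Qed.

Lemma Ck_pairr V V' W k (U : set V') (U' : set (V * V')) (g : V * V' -> W) c :
  open U -> (forall x, U x -> U' (c, x)) -> Ck_on k U' g ->
  Ck_on k U (g \o (fun x => (c, x))).
Proof.
move=> oU UU' Cg; pose L (x : V') : V * V' := (0, x).
have Ll : linear L.
  by move=> a u v; congr pair; rewrite /= scaler0 addr0.
pose L' : {linear V' -> (V * V')%type} :=
  HB.pack L (GRing.isLinear.Build _ _ _ _ L Ll).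
have E x : L' x + (c, 0) = (c, x) by congr pair; rewrite /= ?addr0 ?add0r.
have -> : g \o (fun x => (c, x)) = fun x => g (L' x + (c, 0)).
  by apply/funext => x /=; rewrite E.
apply: (@Ck_affine _ _ _ _ _ U') => //; last by move=> x Ux; rewrite E; exact: UU'.
by move=> x; apply: cvg_pair; [exact: cvg_cst|exact: cvg_id].
Qed.
End smooth.

Section manifold.
Variable R : realType.

Record chart (T : topologicalType) (n : nat) := Chart {
  chart_dom : set T;
  chart_fun :> T -> 'rV[R]_n;
  chart_inv : 'rV[R]_n -> T;
  open_chart_dom : open chart_dom;
  open_chart_img : open (chart_fun @` chart_dom);
  chartK : {in chart_dom, cancel chart_fun chart_inv};
  chart_continuous : {in chart_dom, continuous chart_fun};
  chart_inv_continuous : {in chart_fun @` chart_dom, continuous chart_inv} }.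

(* The atlas need not be maximal: it defines the same smooth functions and maps
   as the maximal atlas that contains it. *)
Record manifold := Manifold {
  mfd_space :> topologicalType;
  mfd_dim : nat;
  atlas : set (chart mfd_space mfd_dim);
  mfd_hausdorff : hausdorff_space mfd_space;
  mfd_second_countable : @second_countable mfd_space;
  atlas_cover : \bigcup_(a in atlas) chart_dom a = [set: mfd_space];
  atlas_compat : forall a b, atlas a -> atlas b ->
    smooth_on (a @` (chart_dom a `&` chart_dom b)) (b \o chart_inv a) }.

Section smooth_functions.
Variable M : manifold.

Definition smooth_fun_on (W : set M) (f : M -> R) := forall a, atlas a ->
  smooth_on (a @` (chart_dom a `&` W)) (f \o chart_inv a).

Lemma open_chart_image a (W : set M) : @atlas M a -> open W -> open (a @` (chart_dom a `&` W)).
Proof.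
move=> _ oW; rewrite openE => _ [x [ax Wx] <-].
have imx : (a @` chart_dom a) (a x) by exists x.
have /(_ W) := chart_inv_continuous (mem_set imx).
rewrite chartK ?inE // => /(_ (open_nbhs_nbhs (conj oW Wx))) nW.
have {}nW : nbhs (a x) (chart_inv a @^-1` W) by exact: nW.
have nI : nbhs (a x) (a @` chart_dom a).
  by apply: open_nbhs_nbhs; split=> //; exact: open_chart_img.
apply: (filterS _ (filterI nW nI)) => u [/= Wu [y ay yu]]; exists y => //; split=> //.
by move: Wu; rewrite -yu chartK ?inE.
Qed.

Definition smooth_pred : {pred M -> R} := mem [set f | smooth_fun_on setT f].

Lemma smooth_subring : subring_closed smooth_pred.
Proof.
split=> [|f g|f g]; rewrite !inE => /=.
- by move=> a _ k; exact: Ck_cst.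
- move=> sf sg a aa k; have oI := open_chart_image aa openT.
  rewrite (_ : _ \o _ = (f \o chart_inv a) + (fun=> (-1)) * (g \o chart_inv a)).
    apply: Ck_add => //; first exact: sf.
    apply: Ck_mul => //; first exact: Ck_cst.
    exact: sg.
  by apply/funext => u; rewrite !fctE /= mulN1r.
- move=> sf sg a aa k; have oI := open_chart_image aa openT.
  by apply: Ck_mul => //; [exact: sf|exact: sg].
Qed.
HB.instance Definition _ :=
  GRing.isSubringClosed.Build _ smooth_pred smooth_subring.

Lemma smooth_scale : GRing.scaler_closed smooth_pred.
Proof.
move=> c f; rewrite !inE /= => sf a aa k; have oI := open_chart_image aa openT.
rewrite (_ : _ \o _ = (fun=> c) * (f \o chart_inv a)) //.
by apply: Ck_mul => //; [exact: Ck_cst|exact: sf].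
Qed.
HB.instance Definition _ :=
  GRing.isScaleClosed.Build _ _ smooth_pred smooth_scale.

Record Cinf := MkCinf { Cinf_fun :> M -> R; Cinf_smooth : Cinf_fun \in smooth_pred }.
HB.instance Definition _ := [isSub for Cinf_fun].
HB.instance Definition _ := [Choice of Cinf by <:].
HB.instance Definition _ := 
  GRing.SubChoice_isSubComPzRing.Build _ _ Cinf smooth_subring.
HB.instance Definition _ := [SubZmodule_isSubLmodule of Cinf by <:].

End smooth_functions.

Definition smooth_map (M N : manifold) (F : M -> N) := continuous F /\
  forall a b, atlas a -> atlas b ->
    smooth_on (a @` (chart_dom a `&` F @^-1` chart_dom b))
              (b \o F \o chart_inv a).

Definition smooth_map2 (M N P : manifold) (F : M -> N -> P) :=
  continuous (fun p : M * N => F p.1 p.2) /\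
  forall a b c, atlas a -> atlas b -> atlas c ->
    smooth_on [set w | [/\ (a @` chart_dom a) w.1, (b @` chart_dom b) w.2 &
                        chart_dom c (F (chart_inv a w.1) (chart_inv b w.2))]]
      (fun w => c (F (chart_inv a w.1) (chart_inv b w.2))).

Lemma atlas_at (M : manifold) (x : M) : exists2 a, atlas a & chart_dom a x.
Proof.
have : [set: M] x by [].
by rewrite -(atlas_cover M) => -[a aa ax]; exists a.
Qed.

Lemma open_preimage (S T : topologicalType) (F : S -> T) (A : set T) :
  continuous F -> open A -> open (F @^-1` A).
Proof. by move=> /continuousP; exact. Qed.

Lemma pullback_subproof (M N : manifold) (F : M -> N) (f : Cinf N) :
  smooth_map F -> f \o F \in @smooth_pred M.
Proof.
move=> [cF sF]; rewrite inE => a aa k; apply: Ck_local => _ [x [ax _] <-].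
have [b ab bx] := atlas_at (F x).
exists (a @` (chart_dom a `&` F @^-1` chart_dom b)); first by exists x.
have oD : open (a @` (chart_dom a `&` F @^-1` chart_dom b)).
  by apply: open_chart_image => //; apply: open_preimage => //; exact: open_chart_dom.
apply: (@Ck_eq _ _ _ _ _ ((f \o chart_inv b) \o (b \o F \o chart_inv a))) => //.
  by move=> _ [y [ay by_] <-] /=; rewrite !chartK ?inE // chartK ?inE.
apply: (@Ck_comp _ _ _ _ _ (b @` (chart_dom b `&` setT))) => //.
- move=> _ [y [ay by_] <-] /=; rewrite chartK ?inE //.
  by exists (F y).
- exact: sF.
- by have := Cinf_smooth f; rewrite inE; exact.
Qed.

Definition pullback (M N : manifold) (F : M -> N) (sF : smooth_map F)
  (f : Cinf N) : Cinf M := MkCinf (pullback_subproof f sF).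

Lemma smooth_slicel (M N P : manifold) (F : M -> N -> P) (y : N) :
  smooth_map2 F -> smooth_map (F ^~ y).
Proof.
move=> [cF sF].
have cFy : continuous (F ^~ y).
  move=> x; apply: (@continuous_comp _ _ _ (fun x => (x, y)) (fun p => F p.1 p.2)).
    by apply: cvg_pair; [exact: cvg_id|exact: cvg_cst].
  exact: cF.
split=> // a c aa ac k; have [b ab bY] := atlas_at y.
have oD : open (a @` (chart_dom a `&` (F ^~ y) @^-1` chart_dom c)).
  by apply: open_chart_image => //; apply: open_preimage => //; exact: open_chart_dom.
apply: (@Ck_eq _ _ _ _ _ ((fun w => c (F (chart_inv a w.1) (chart_inv b w.2)))
                            \o (fun u => (u, b y)))) => //.
  by move=> u _ /=; rewrite (chartK (mem_set bY)).
apply: (@Ck_pairl _ _ _ _ _ _ _ _ (b y)) (sF a b c aa ab ac k) => //.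
move=> _ [x [ax cx] <-] /=; rewrite !chartK ?inE //; split=> //.
  by exists x.
by exists y.
Qed.

Lemma smooth_slicer (M N P : manifold) (F : M -> N -> P) (x : M) :
  smooth_map2 F -> smooth_map (F x).
Proof.
move=> [cF sF].
have cFx : continuous (F x).
  move=> y; apply: (@continuous_comp _ _ _ (fun y => (x, y)) (fun p => F p.1 p.2)).
    by apply: cvg_pair; [exact: cvg_cst|exact: cvg_id].
  exact: cF.
split=> // b c ab ac k; have [a aa aX] := atlas_at x.
have oD : open (b @` (chart_dom b `&` F x @^-1` chart_dom c)).
  by apply: open_chart_image => //; apply: open_preimage => //; exact: open_chart_dom.
apply: (@Ck_eq _ _ _ _ _ ((fun w => c (F (chart_inv a w.1) (chart_inv b w.2)))
                            \o (fun u => (a x, u)))) => //.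
  by move=> u _ /=; rewrite (chartK (mem_set aX)).
apply: (@Ck_pairr _ _ _ _ _ _ _ _ (a x)) (sF a b c aa ab ac k) => //.
move=> _ [y [ay cy] <-] /=; rewrite !chartK ?inE //; split=> //.
  by exists x.
by exists y.
Qed.

(* Tangent vectors at x are the derivations at x of the algebra Cinf M. *)
Section tangent.
Variables (M : manifold) (x : M).
Definition tangent_pred : {pred Cinf M -> R^o} := mem [set v |
   scalar v /\ forall f g : Cinf M, v (f * g) = f x * v g + g x * v f].
Lemma tangent_submod : submod_closed tangent_pred.
Proof.
split=> [|c u v]; rewrite !inE => /=.
  split=> [a f g|f g]; first by rewrite -[LHS]/0 -[RHS]/(a * 0 + 0) mulr0 addr0.
  by rewrite -[LHS]/0 -[RHS]/(f x * 0 + g x * 0) !mulr0 addr0.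
have E w : (c *: u + v) w = c * u w + v w by [].
move=> [lu du] [lv dv]; split=> [a f g|f g]; rewrite !E.
  by rewrite lu lv; ring.
by rewrite du dv; ring.
Qed.
HB.instance Definition _ :=
  GRing.isSubmodClosed.Build _ _ tangent_pred tangent_submod.
Record tangent := MkTangent { tangent_fun :> Cinf M -> R^o; tangentP : tangent_fun \in tangent_pred }.
HB.instance Definition _ := [isSub for tangent_fun].
HB.instance Definition _ := [Choice of tangent by <:].
HB.instance Definition _ := [SubChoice_isSubLmodule of tangent by <:].
End tangent.

Section pushforward.
Variables (M N : manifold) (F : M -> N) (sF : smooth_map F).
Variables (x : M) (y : N) (Fxy : F x = y).

Lemma pushforward_subproof (v : tangent x) :
  (fun f => v (pullback sF f)) \in @tangent_pred _ y.
Proof.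
have := tangentP v; rewrite !inE => -[vl vd]; split=> [a f g|f g].
  by rewrite -vl; congr (v _); exact: val_inj.
rewrite -Fxy; apply: etrans (vd (pullback sF f) (pullback sF g)).
by congr (v _); exact: val_inj.
Qed.

Definition pushforward (v : tangent x) : tangent y :=
  MkTangent (pushforward_subproof v).

End pushforward.
End manifold.

Section lie_groups.
Variable R : realType.

Record lie_group := LieGroup {
  lg_mfd :> manifold R;
  lg_one : lg_mfd;
  lg_mul : lg_mfd -> lg_mfd -> lg_mfd;
  lg_inv : lg_mfd -> lg_mfd;
  lg_mulA : associative lg_mul;
  lg_mul1g : left_id lg_one lg_mul;
  lg_mulg1 : right_id lg_one lg_mul;
  lg_mulVg : left_inverse lg_one lg_inv lg_mul;
  lg_mulgV : right_inverse lg_one lg_inv lg_mul;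
  lg_smooth_mul : smooth_map2 lg_mul;
  lg_smooth_inv : smooth_map lg_inv }.

Definition lie_algebra (G : lie_group) := tangent (lg_one G).

Section adjoint.
Variables (G : lie_group) (g : G).

Lemma conj_one : lg_mul (lg_mul g (lg_one G)) (lg_inv g) = lg_one G.
Proof. by rewrite lg_mulg1 lg_mulgV. Qed.

(* Ad_g is the derivative at the unit of h |-> g h g^-1, taken as the
   composite of a left and a right translation. *)
Definition Ad (xi : lie_algebra G) : lie_algebra G :=
  pushforward (smooth_slicel (lg_inv g) (lg_smooth_mul G)) conj_one
    (pushforward (smooth_slicer g (lg_smooth_mul G)) erefl xi).

End adjoint.

Record lie_action (G : lie_group) (M : manifold R) := LieAction {
  act :> G -> M -> M;
  act1 : forall x, act (lg_one G) x = x;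
  actM : forall g h x, act (lg_mul g h) x = act g (act h x);
  act_smooth : smooth_map2 act }.

(* xi_M(x), the derivative at the unit of the orbit map g |-> g x applied
   to xi. *)
Definition inf_gen (G : lie_group) (M : manifold R) (A : lie_action G M)
    (xi : lie_algebra G) (x : M) : tangent x :=
  pushforward (smooth_slicel x (act_smooth A)) (act1 A x) xi.

End lie_groups.

Section linear_algebra.
Variables (R : realType) (E : lmodType R).

Definition lin_span (S : set E) : set E :=
  [set w | exists (n : nat) (c : 'I_n -> R) (v : 'I_n -> E),
     (forall i, S (v i)) /\ w = \sum_i c i *: v i].

Definition is_basis (S : set E) (m : nat) (e : 'I_m -> E) :=
  lin_span (range e) = S /\
  forall c : 'I_m -> R, \sum_i c i *: e i = 0 -> forall i, c i = 0.

End linear_algebra.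

Section geometry.
Variables (R : realType) (M : manifold R).

(* Vector fields are families of tangent vectors; those defined on an open set
   U only are extended arbitrarily, and no condition is put outside U. *)
Definition vfield := forall x : M, tangent x.

Definition smooth_vfield_on (U : set M) (X : vfield) :=
  forall f : Cinf M, smooth_fun_on U (fun x => X x f).

(* A distribution selects a set of tangent vectors at each point. *)
Definition distribution := forall x : M, set (tangent x).

Definition section_on (Delta : distribution) (U : set M) (Z : vfield) :=
  smooth_vfield_on U Z /\ forall x, U x -> Delta x (Z x).

Definition local_frame (Delta : distribution) (U : set M) (m : nat)
    (X : 'I_m -> vfield) :=
  (forall i, smooth_vfield_on U (X i)) /\
  forall x, U x -> is_basis (Delta x) (fun i => X i x).

Definition subbundle (Delta : distribution) :=
  forall x, exists (U : set M) (m : nat) (X : 'I_m -> vfield),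
    [/\ open U, U x & local_frame Delta U X].

Definition constant_dim (Delta : distribution) :=
  exists m, forall x, exists e : 'I_m -> tangent x, is_basis (Delta x) e.

(* w = [X, Z](y), i.e. w[f] = X[Z[f]](y) - Z[X[f]](y); as X and Z may be local,
   X[f] and Z[f] are represented by global functions that agree with them
   near y. *)
Definition lie_bracket_at (X Z : vfield) (y : M) (w : tangent y) :=
  forall f Xf Zf : Cinf M,
    (\forall z \near y, Xf z = X z f) -> (\forall z \near y, Zf z = Z z f) ->
    w f = X y Zf - Z y Xf.

(* b f h stands for {f, h}. *)
Definition generalized_poisson (b : Cinf M -> Cinf M -> Cinf M) :=
  [/\ forall h, linear (b ^~ h),
      forall f h, b f h = - b h f &
      forall f g h, b (f * g) h = f * b g h + g * b f h].

(* Covectors at x are the maps [tangent x -> R^o] satisfying [scalar]. *)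
Definition covector_field_map := forall x : M, (tangent x -> R^o) -> tangent x.

Definition differential (h : Cinf M) (x : M) : tangent x -> R^o :=
  fun v => v h.

Definition bundle_map_of (b : Cinf M -> Cinf M -> Cinf M)
    (J : covector_field_map) :=
  forall x : M,
  [/\ forall (c : R) (al be : tangent x -> R^o), scalar al -> scalar be ->
        J x (c *: al + be) = c *: J x al + J x be,
      forall al be : tangent x -> R^o, scalar al -> scalar be ->
        al (J x be) = - be (J x al) &
      forall f h : Cinf M, differential f (J x (@differential h x)) = b f h x].

(* L_X J = 0, where (L_X J)(df, dh) = X{f, h} - {X f, h} - {f, X h}; L_X J is a
   tensor, so its values on exact forms determine it. *)
Definition lie_derivative_J_eq0 (b : Cinf M -> Cinf M -> Cinf M) (X : vfield) :=
  forall f h Xf Xh : Cinf M,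
    (forall y, Xf y = X y f) -> (forall y, Xh y = X y h) ->
    forall y, X y (b f h) - b Xf h y - b f Xh y = 0.

Definition invariant_along (Delta : distribution) (X : vfield) :=
  forall (U : set M) (Z : vfield), open U -> section_on Delta U Z ->
  exists W : vfield, section_on Delta U W /\
    forall y, U y -> lie_bracket_at X Z (W y).

Definition dirac_structure := forall x : M, set (tangent x * (tangent x -> R^o)).

Definition dirac_of (J : covector_field_map) (Delta : distribution) :
    dirac_structure := fun x =>
  [set p | [/\ scalar p.2, Delta x (p.1 - J x p.2) &
               forall w, Delta x w -> p.2 w = 0]].

Definition smooth_curve (I : set R) (x : R -> M) :=
  {in I, continuous x} /\
  forall a, atlas a -> smooth_on (I `&` x @^-1` chart_dom a : set R^o) (a \o x).

Definition velocity (x : R -> M) (t : R) (v : tangent (x t)) :=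
  forall f : Cinf M, is_derive t 1 (f \o x) (v f).

Definition solution (D : dirac_structure) (H : Cinf M) (I : set R)
    (x : R -> M) :=
  smooth_curve I x /\
  forall t, I t -> exists v : tangent (x t),
    velocity v /\ D (x t) (v, @differential H (x t)).

End geometry.

Section momentum.
Variables (R : realType) (G : lie_group R) (M : manifold R).
Variable A : lie_action G M.

(* A smooth map from M to the dual of the Lie algebra; since the latter is a
   finite-dimensional vector space, smoothness is that of the components. *)
Record dual_map := DualMap {
  dual_map_fun :> M -> lie_algebra G -> R^o;
  dual_map_scalar : forall x, scalar (dual_map_fun x);
  dual_map_smooth : forall xi,
    (fun x => dual_map_fun x xi) \in @smooth_pred R M }.

Definition component (P : dual_map) (xi : lie_algebra G) : Cinf M :=
  MkCinf (dual_map_smooth P xi).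

Definition momentum_map (D : dirac_structure M) (P : dual_map) :=
  forall xi x, D x (inf_gen A xi x, @differential _ _ (component P xi) x).

Definition Ad_star_equivariant (P : dual_map) :=
  forall g x xi, P (A g x) xi = P x (Ad (lg_inv g) xi).

Definition zero_level (P : dual_map) : set M := [set x | forall xi, P x xi = 0].

Definition invariant_fun (f : M -> R) := forall g x, f (A g x) = f x.

Definition V_sum (Delta : distribution M) : distribution M := fun x =>
  [set v + w | v in lin_span (range (fun xi => inf_gen A xi x)) & w in Delta x].

End momentum.

Section reduced_space.
Variables (R : realType) (G : lie_group R) (M : manifold R).
Variables (A : lie_action G M) (N : set M).

Definition same_orbit : rel N :=
  fun x y => `[< exists g, A g (\val x) = \val y >].

Lemma same_orbit_refl : reflexive same_orbit.
Proof. by move=> x; apply/asboolP; exists (lg_one G); rewrite act1. Qed.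

Lemma same_orbit_sym : symmetric same_orbit.
Proof.
suff h x y : same_orbit x y -> same_orbit y x.
  by move=> x y; apply/idP/idP; exact: h.
move=> /asboolP[g gxy]; apply/asboolP; exists (lg_inv g).
by rewrite -gxy -actM lg_mulVg act1.
Qed.

Lemma same_orbit_trans : transitive same_orbit.
Proof.
move=> y x z /asboolP[g gxy] /asboolP[h hyz]; apply/asboolP.
by exists (lg_mul h g); rewrite actM gxy hyz.
Qed.

Definition same_orbit_equiv :=
  EquivRel same_orbit same_orbit_refl same_orbit_sym same_orbit_trans.

Definition reduced : topologicalType :=
  quotient_topology {eq_quot same_orbit_equiv}%qT.

Definition reduce (x : N) : reduced := \pi_({eq_quot same_orbit_equiv}%qT)%qT x.

Definition restricts_to (f : M -> R) (f0 : reduced -> R) :=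
  forall x : N, f0 (reduce x) = f (\val x).

Definition smooth_pred0 : {pred reduced -> R} :=
  mem [set f0 | continuous f0 /\
    exists f : Cinf M, invariant_fun A f /\ restricts_to f f0].

Lemma smooth0_subring : subring_closed smooth_pred0.
Proof.
split=> [|f g|f g]; rewrite !inE => /=.
- split; first by move=> p; exact: (@cst_continuous reduced R 1).
  by exists 1.
- move=> [cf [f' [If Rf]]] [cg [g' [Ig Rg]]]; split.
    by move=> p; apply: continuousB; [exact: cf|exact: cg].
  exists (f' - g'); split=> [h x|x].
    by rewrite -[LHS]/(f' (A h x) - g' (A h x)) If Ig.
  by rewrite -[LHS]/(f (reduce x) - g (reduce x)) Rf Rg.
- move=> [cf [f' [If Rf]]] [cg [g' [Ig Rg]]]; split.
    by move=> p; apply: continuousM; [exact: cf|exact: cg].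
  exists (f' * g'); split=> [h x|x].
    by rewrite -[LHS]/(f' (A h x) * g' (A h x)) If Ig.
  by rewrite -[LHS]/(f (reduce x) * g (reduce x)) Rf Rg.
Qed.
HB.instance Definition _ :=
  GRing.isSubringClosed.Build _ smooth_pred0 smooth0_subring.

Lemma smooth0_scale : GRing.scaler_closed smooth_pred0.
Proof.
move=> c f; rewrite !inE /= => -[cf [f' [If Rf]]]; split.
  by move=> p; apply: continuousM; [exact: (@cst_continuous reduced R c)|exact: cf].
exists (c *: f'); split=> [h x|x].
  by rewrite -[LHS]/(c * f' (A h x)) If.
by rewrite -[LHS]/(c * f (reduce x)) Rf.
Qed.
HB.instance Definition _ :=
  GRing.isScaleClosed.Build _ _ smooth_pred0 smooth0_scale.

Record Cinf0 := MkCinf0 {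
  Cinf0_fun :> reduced -> R; Cinf0_smooth : Cinf0_fun \in smooth_pred0 }.
HB.instance Definition _ := [isSub for Cinf0_fun].
HB.instance Definition _ := [Choice of Cinf0 by <:].
HB.instance Definition _ := 
  GRing.SubChoice_isSubComPzRing.Build _ _ Cinf0 smooth0_subring.
HB.instance Definition _ := [SubZmodule_isSubLmodule of Cinf0 by <:].

Definition derivation (X : Cinf0 -> Cinf0) :=
  linear X /\ forall f g, X (f * g) = f * X g + g * X f.

Definition at_point (X : Cinf0 -> Cinf0) (p : reduced) : Cinf0 -> R^o :=
  fun f0 => X f0 p.

Definition projects_to (U : set M) (X : vfield M) (Xh : Cinf0 -> Cinf0) :=
  derivation Xh /\
  forall (x : N) (f : Cinf M) (f0 : Cinf0), U (\val x) ->
    invariant_fun A f -> restricts_to f f0 ->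
    X (\val x) f = Xh f0 (reduce x).

(* The bracket on the quotient, given by its defining property, which
   determines b0 uniquely; it holds for all invariant extensions f and h. *)
Definition reduced_bracket (b : Cinf M -> Cinf M -> Cinf M)
    (b0 : Cinf0 -> Cinf0 -> Cinf0) :=
  forall (f h : Cinf M) (f0 h0 : Cinf0),
    invariant_fun A f -> invariant_fun A h ->
    restricts_to f f0 -> restricts_to h h0 ->
    restricts_to (b f h) (b0 f0 h0).

Definition fiber (Dh : set (Cinf0 -> Cinf0)) (p : reduced) :
    set (Cinf0 -> R^o) := [set at_point Z p | Z in Dh].

(* Dh is the reduced distribution, given by its defining property: a vector
   space of derivations which, around the image of every point of N, is
   spanned by the projections of a local frame of Delta made of projectable
   vector fields. *)
Definition reduced_distribution (Delta : distribution M)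
    (Dh : set (Cinf0 -> Cinf0)) :=
  [/\ forall Z, Dh Z -> derivation Z,
      Dh 0,
      forall (c : R) Z W, Dh Z -> Dh W -> Dh (c *: Z + W) &
      forall x : N, exists (U : set M) (m : nat) (X : 'I_m -> vfield M)
          (Xh : 'I_m -> Cinf0 -> Cinf0),
        [/\ open U /\ U (\val x), local_frame Delta U X,
            forall i, projects_to U (X i) (Xh i) &
            forall y : N, U (\val y) ->
              fiber Dh (reduce y) =
              lin_span (range (fun i => at_point (Xh i) (reduce y)))]].

Definition smooth_curve0 (I : set R) (gamma : R -> reduced) :=
  {in I, continuous gamma} /\
  forall f0 : Cinf0, smooth_on (I : set R^o) (f0 \o gamma : R^o -> R^o).

Definition integral_curve (Xh : Cinf0 -> Cinf0) (I : set R)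
    (gamma : R -> reduced) :=
  smooth_curve0 I gamma /\
  forall t (f0 : Cinf0), I t ->
    is_derive t 1 (f0 \o gamma) (Xh f0 (gamma t)).

Definition solution0 (b0 : Cinf0 -> Cinf0 -> Cinf0)
    (Dh : set (Cinf0 -> Cinf0)) (H0 : Cinf0) (I : set R)
    (gamma : R -> reduced) :=
  smooth_curve0 I gamma /\
  exists Xh, [/\ derivation Xh, integral_curve Xh I gamma &
    forall t, I t ->
      fiber Dh (gamma t)
        (at_point Xh (gamma t) - at_point (b0 ^~ H0) (gamma t)) /\
      forall Z, Dh Z -> Z H0 (gamma t) = 0].

Definition projectable_solution (D : dirac_structure M) (H : Cinf M)
    (I : set R) (x : R -> M) :=
  solution D H I x /\
  exists X Xh, [/\ smooth_vfield_on setT X, projects_to setT X Xh &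
    forall t, I t -> velocity (X (x t))].

End reduced_space.

(* Main.v *)
Require Import Defs.
From HB Require Import structures.
From mathcomp Require Import all_boot all_order all_algebra.
From mathcomp Require Import all_classical all_reals topology normedtype landau derive.
Set Implicit Arguments.
Unset Strict Implicit.
Unset Printing Implicit Defensive.
Import Order.TTheory GRing.Theory Num.Theory numFieldNormedType.Exports.
Local Open Scope classical_set_scope.
Local Open Scope ring_scope.

(* The momentum is constant along solutions, so x(t) stays in N = P^-1(0) and
   has a projection gamma. By the definition of C^oo(M_0), functions on gamma are
   invariant functions on x(t), so gamma is an integral curve of the projection
   of X. Expanding x'(t) - J dH in Delta(x(t)) along a projectable local frame of
   Delta and testing it on invariant functions gives an expansion of
   Xh - {., H_0}_0 along the projected frame; likewise dH vanishing on the frame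
   gives Z[H_0] = 0. *)

(** The mean value theorem applies on the segment from [s] to [t], which stays in [I] because [I] is
    an interval. *)
Lemma derive0_interval_cst (R : realType) (I : set R) (f : R -> R) :
  is_interval I -> (forall t, I t -> is_derive t 1 f 0) ->
  forall s t, I s -> I t -> f s = f t.
Proof.
move=> itvI df.
have le_cst s t : I s -> I t -> s <= t -> f s = f t.
  move=> Is It st.
  have Ist u : u \in `[s, t] -> I u.
    by rewrite in_itv /= => su; exact: (itvI s t).
  have cf : {within `[s, t], continuous f}.
    apply: derivable_within_continuous => u /Ist Iu.
    by have [] := df _ Iu.
  have [u|c _ /eqP] := @MVT_segment R f (fun=> 0) s t st _ cf.
    by move=> /subset_itv_oo_cc /Ist; exact: df.
  by rewrite mul0r subr_eq0 => /eqP.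
move=> s t Is It; have [st|/ltW ts] := leP s t; first exact: le_cst.
by apply/esym/le_cst.
Qed.

Section tangent_vectors.
Variables (R : realType) (M : manifold R).
Implicit Types (y : M) (f g : Cinf M).

(** The Leibniz rule on [1 * 1] gives [v 1 = 0], and a constant function is a multiple of [1]. *)
Lemma tangent_cst y (v : tangent y) f : (forall z, f z = f y) -> v f = 0.
Proof.
have [vl vd] : scalar v /\ forall f g, v (f * g) = f y * v g + g y * v f.
  by have := tangentP v; rewrite inE.
move=> fcst.
have v1 : v 1 = 0.
  have := vd 1 1; rewrite mulr1 -[(1 : Cinf M) y]/(1 : R) !mul1r => /esym/eqP.
  by rewrite -subr_eq0 addrK => /eqP.
have v0 : v 0 = 0.
  by rewrite -(mul0r 0) vd -[(0 : Cinf M) y]/(0 : R) mul0r addr0.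
(* The summand [0] fits the shape of [scalar v], which reads [v (a *: f + g) = a * v f + v g]. *)
have -> : f = f y *: (1 : Cinf M) + 0.
  by apply: val_inj; apply/funext => z; rewrite addr0 -[RHS]/(f y * 1) mulr1; exact: fcst.
by rewrite vl v1 v0 mulr0 addr0.
Qed.

Lemma tangentB y (u v : tangent y) f : (u - v) f = u f - v f.
Proof. by []. Qed.

Lemma tangent_sum y n (c : 'I_n -> R) (v : 'I_n -> tangent y) f :
  (\sum_i c i *: v i) f = \sum_i c i * v i f.
Proof.
by apply: (big_ind2 (fun (u : tangent y) (r : R) => u f = r)) => // u _ v' _ <- <-.
Qed.

(** Smoothness is local, and near [t] the function factors through a chart [a] at [x t], as
    [(f \o chart_inv a) \o (a \o x)]. *)
Lemma smooth_curve_comp (I : set R) (x : R -> M) f : open I ->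
  smooth_curve I x -> smooth_on (I : set R^o) (f \o x : R^o -> R^o).
Proof.
move=> oI [cx sx] k; apply: Ck_local => t It.
have [a aa ax] := atlas_at (x t).
exists (I `&` x @^-1` chart_dom a) => //.
have oIa : open (I `&` x @^-1` chart_dom a).
  rewrite openE => s [Is xs]; apply: filterI; first exact: open_nbhs_nbhs.
  by apply: (cx s (mem_set Is)); apply: open_nbhs_nbhs; split => //;
    exact: open_chart_dom.
apply: (@Ck_eq _ _ _ _ _ ((f \o chart_inv a) \o (a \o x))) => //.
  by move=> s [_ xs] /=; rewrite chartK ?inE.
apply: (@Ck_comp _ _ _ _ _ (a @` (chart_dom a `&` setT))) => //.
- by move=> s [_ xs] /=; exists (x s).
- exact: sx.
- by have := Cinf_smooth f; rewrite inE; exact.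
Qed.

End tangent_vectors.

Section conservation.
Variables (R : realType) (M : manifold R).
Variables (b : Cinf M -> Cinf M -> Cinf M) (J : covector_field_map M).
Variable Delta : distribution M.
Variables (G : lie_group R) (A : lie_action G M) (H : Cinf M) (P : dual_map G M).
Variables (I : set R) (x : R -> M).

(** The pullback of [H] along the orbit map of [y] is constant, so the tangent vector [xi] at the
    unit kills it. *)
Lemma inf_gen_invariant xi y : invariant_fun A H -> inf_gen A xi y H = 0.
Proof.
move=> invH; rewrite /inf_gen /pushforward /=; apply: tangent_cst => g.
by rewrite -[LHS]/(H (A g y)) -[RHS]/(H (A (lg_one G) y)) !invH.
Qed.

(* v[P_xi] = dP_xi(J dH) = - dH(J dP_xi) = - xi_M[H] = 0, because both dP_xi
   and dH annihilate Delta, which contains v - J dH and xi_M - J dP_xi. *)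
Lemma component_velocity xi y (v : tangent y) :
  bundle_map_of b J -> invariant_fun A H ->
  momentum_map A (dirac_of J Delta) P ->
  dirac_of J Delta (v, @differential _ _ H y) -> v (component P xi) = 0.
Proof.
move=> bJ invH mP [_ DvH DH] /=; have [_ skewJ _] := bJ y.
have [_ DxP DP] := mP xi y.
have vP : v (component P xi) = J (@differential _ _ H y) (component P xi).
  by apply/eqP; rewrite -subr_eq0 -tangentB; exact/eqP/(DP _ DvH).
have xH : inf_gen A xi y H = J (@differential _ _ (component P xi) y) H.
  by apply/eqP; rewrite -subr_eq0 -tangentB; exact/eqP/(DH _ DxP).
rewrite vP -[LHS]/(differential (component P xi) _) skewJ //.
by rewrite /differential -xH inf_gen_invariant // oppr0.
Qed.

Lemma solution_zero_level :
  bundle_map_of b J -> invariant_fun A H ->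
  momentum_map A (dirac_of J Delta) P -> is_interval I -> I 0 ->
  solution (dirac_of J Delta) H I x -> zero_level P (x 0) ->
  forall t, I t -> zero_level P (x t).
Proof.
move=> bJ invH mP itvI I0 [_ sx] P0 t It xi.
rewrite -(P0 xi).
apply: (@derive0_interval_cst R I (component P xi \o x)) => // s Is.
have [v [vx Dv]] := sx s Is.
by apply: is_derive_eq (vx (component P xi)) _; exact: component_velocity Dv.
Qed.

End conservation.

Section reduced_curve.
Variables (R : realType) (G : lie_group R) (M : manifold R).
Variables (A : lie_action G M) (N : set M).

Lemma reduce_continuous : continuous (@reduce _ _ _ A N).
Proof. exact: pi_continuous. Qed.

Variables (I : set R) (x : R -> M) (y : R -> N).
Hypotheses (oI : open I) (yx : forall t, I t -> \val (y t) = x t).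

(** Transferring a derivative from [f \o x] to the reduced curve takes agreement on a neighborhood
    of [t], which the openness of [I] provides. *)
Lemma near_restricts_to f (f0 : reduced A N -> R) t : restricts_to f f0 -> I t ->
  \forall s \near t, f (x s) = f0 (reduce A (y s)).
Proof.
move=> ff0 It; near=> s; rewrite ff0 yx //; near: s.
exact: open_nbhs_nbhs.
Unshelve. all: by end_near.
Qed.

Lemma reduce_curve_continuous : {in I, continuous x} ->
  {in I, continuous (fun t => reduce A (y t))}.
Proof.
move=> cx t /[!inE] It.
apply: (@continuous_comp _ _ _ y (@reduce _ _ _ A N)); last first.
  exact: reduce_continuous.
(* Open sets of the subspace [N] are traces of open sets [C] of [M], so continuity of [x] in [M]
   suffices. *)
move=> B [_ [[C oC <-] Cyt] sCB].
have : \forall s \near t, C (x s).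
  by apply: (cx t (mem_set It)); apply: open_nbhs_nbhs; split=> //; rewrite -yx.
apply: filterS2 (open_nbhs_nbhs (conj oI It)) => s Is Cs.
by apply: sCB; suff : C (\val (y s)) by []; rewrite yx.
Qed.

Lemma Cinf0_extension (f0 : Cinf0 A N) :
  exists2 f : Cinf M, invariant_fun A f & restricts_to f f0.
Proof. by have := Cinf0_smooth f0; rewrite inE => -[_ [f []]]; exists f. Qed.

Lemma reduce_smooth_curve : smooth_curve I x ->
  smooth_curve0 I (fun t => reduce A (y t)).
Proof.
move=> sx; split; first by apply: reduce_curve_continuous; case: sx.
move=> f0 k; have [f _ ff0] := Cinf0_extension f0.
apply: (@Ck_eq _ _ _ _ _ (f \o x)) => //; last exact: smooth_curve_comp.
by move=> t It /=; rewrite ff0 yx.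
Qed.

Lemma reduce_integral_curve X Xh : smooth_curve I x ->
  projects_to setT X Xh -> (forall t, I t -> velocity (X (x t))) ->
  integral_curve Xh I (fun t => reduce A (y t)).
Proof.
move=> sx [_ XXh] vX; split=> [|t f0 It]; first exact: reduce_smooth_curve.
have [f invf ff0] := Cinf0_extension f0.
have := XXh (y t) f f0 Logic.I invf ff0; rewrite yx // => <-.
by apply: near_eq_is_derive (vX t It f); exact: near_restricts_to.
Qed.

End reduced_curve.

Section reduced_distribution.
Variables (R : realType) (G : lie_group R) (M : manifold R).
Variables (A : lie_action G M) (N : set M) (Delta : distribution M).
Variable Dh : set (Cinf0 A N -> Cinf0 A N).
Hypothesis redDh : reduced_distribution Delta Dh.

(** At [reduce A y], [Z] is a combination of the projected frame fields, and [Xh j] on [H0] equals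
    [X j] on [H], which vanishes. *)
Lemma reduced_distribution_annihilates (y : N) (H : Cinf M) (H0 : Cinf0 A N) :
  invariant_fun A H -> restricts_to H H0 ->
  (forall w : tangent (\val y), Delta w -> w H = 0) ->
  forall Z, Dh Z -> Z H0 (reduce A y) = 0.
Proof.
move=> invH HH0 DH Z DhZ.
have [_ _ _ /(_ y)[U [m [X [Xh [[_ Uy] [_ XD] XXh Dhy]]]]]] := redDh.
have : fiber Dh (reduce A y) (at_point Z (reduce A y)) by exists Z.
rewrite Dhy // => -[n [c [v [vX ZE]]]].
rewrite -[LHS]/(at_point Z (reduce A y) H0) ZE fct_sumE big1 // => i _.
have [j _ <-] := vX i.
have [_ XXhj] := XXh j; have [Dspan _] := XD _ Uy.
rewrite -[LHS]/(c i * Xh j H0 (reduce A y)) -(XXhj y H H0) // DH ?mulr0 //.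
(* A frame vector lies in [Delta] as a one-term combination of the frame. *)
rewrite -Dspan; exists 1, (fun=> 1), (fun=> X j (\val y)); split=> [_|].
  by exists j.
by rewrite big_ord1 scale1r.
Qed.

(** The coefficients of [v] in the frame serve unchanged for [d], since every [f0] has an invariant
    extension [f] on which to compare them. *)
Lemma fiber_of_distribution (y : N) (v : tangent (\val y))
    (d : Cinf0 A N -> R^o) :
  Delta v ->
  (forall (f : Cinf M) (f0 : Cinf0 A N), invariant_fun A f -> restricts_to f f0 -> d f0 = v f) ->
  fiber Dh (reduce A y) d.
Proof.
have [_ _ _ /(_ y)[U [m [X [Xh [[_ Uy] [_ XD] XXh Dhy]]]]]] := redDh.
have [<- _] := XD _ Uy; move=> [n [c [w [wX vE]]]] dE.
(* Combinations in [lin_span] may list frame vectors in any order and with repetitions, hence the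
   reindexing [j]. *)
have /choice[j jX] : forall i, exists j, X j (val y) = w i.
  by move=> i; have [j _ <-] := wX i; exists j.
rewrite Dhy //; exists n, c, (fun i => at_point (Xh (j i)) (reduce A y)).
split=> [i|]; first by exists (j i).
apply/funext => f0; have [f invf ff0] := Cinf0_extension f0.
rewrite (dE _ _ invf ff0) vE tangent_sum fct_sumE; apply: eq_bigr => i _.
have [_ XXhj] := XXh (j i).
by rewrite -jX (XXhj y f f0).
Qed.

End reduced_distribution.

Theorem proposition22 (R : realType)
    (M : manifold R)
    (b : Cinf M -> Cinf M -> Cinf M) (J : covector_field_map M)
    (Delta : distribution M)
    (G : lie_group R) (A : lie_action G M)
    (H : Cinf M) (P : dual_map G M)
    (b0 : Cinf0 A (zero_level P) -> Cinf0 A (zero_level P) ->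
          Cinf0 A (zero_level P))
    (Dh : set (Cinf0 A (zero_level P) -> Cinf0 A (zero_level P)))
    (H0 : Cinf0 A (zero_level P))
    (I : set R) (x : R -> M) :
  generalized_poisson b -> bundle_map_of b J ->
  subbundle Delta ->
  (forall xi : lie_algebra G, lie_derivative_J_eq0 b (inf_gen A xi)) ->
  (forall xi : lie_algebra G, invariant_along Delta (inf_gen A xi)) ->
  invariant_fun A H ->
  momentum_map A (dirac_of J Delta) P -> Ad_star_equivariant A P ->
  constant_dim (V_sum A Delta) ->
  reduced_bracket b b0 -> reduced_distribution Delta Dh ->
  restricts_to H H0 ->
  open I -> is_interval I -> I 0 ->
  projectable_solution A (zero_level P) (dirac_of J Delta) H I x ->
  zero_level P (x 0) ->
  exists gamma : R -> reduced A (zero_level P),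
    (forall t, I t -> exists2 y : zero_level P,
       \val y = x t & gamma t = reduce A y) /\
    solution0 b0 Dh H0 I gamma.
Proof.
move=> _ bJ _ _ _ invH mP _ _ bb0 redDh HH0 oI itvI I0 [solx [X [Xh [_ XXh vX]]]] P0.
have Nx := solution_zero_level bJ invH mP itvI I0 solx P0.
have [sx DHx] := solx.
have [y yx] : exists y : R -> zero_level P, forall t, I t -> \val (y t) = x t.
  have /choice[y yx] : forall t, exists z : zero_level P, I t -> \val z = x t.
    move=> t; have [It|nIt] := pselect (I t).
      by exists (exist _ (x t) (mem_set (Nx t It))).
    (* Outside [I] the lift takes the default value [x 0], a point of the zero level. *)
    by exists (exist _ (x 0) (mem_set P0)).
  by exists y.
exists (fun t => reduce A (y t)); split.
  by move=> t It; exists (y t); rewrite ?yx.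
split; first exact: reduce_smooth_curve oI yx sx.
exists Xh; split; first by case: XXh.
  exact: (reduce_integral_curve oI yx sx XXh vX).
move=> t It.
have [DXH DeltaH] : Delta (x t) (X (x t) - J (x t) (@differential _ _ H (x t))) /\
    forall w, Delta (x t) w -> w H = 0.
  have [v [vx [_ DvH DeltaH]]] := DHx t It.
  (* Tangent vectors are functionals on [Cinf M], and both send [f] to the derivative of [f \o x] at
     [t]. *)
  suff -> : X (x t) = v by [].
  apply: val_inj; apply/funext => f.
  have [_ vf] := vx f; have [_ Xf] := vX t It f.
  exact: etrans (esym Xf) vf.
move: DXH DeltaH; rewrite -(yx t It) => DXH DeltaH; split; last first.
  exact: (reduced_distribution_annihilates redDh invH HH0 DeltaH).
apply: (fiber_of_distribution redDh DXH) => f f0 invf ff0.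
have [_ XXh0] := XXh; rewrite tangentB (XXh0 (y t) f f0) //.
(* [J dH] acts on [f] as [b f H], which descends to [b0 f0 H0]. *)
have [_ _ /(_ f H)] := bJ (\val (y t)); rewrite /differential => ->.
by rewrite -(bb0 f H f0 H0).
Qed.
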